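(* Let $q\ge 2$ be an integer, let $d_0,d_1$ be integers with $0\le d_0,d_1<q$, let $\gamma_0,\gamma_1\in[0,q-1)$, and put $\delta_0=\frac{d_0}{q}$, $\delta_1=\frac{d_1}{q}$. For $j\in\{0,1\}$ let $$r_j=(1-\delta_j)\left[\left(1+\frac{\gamma_j}{1-\delta_j}\right)\log_q\frac{q-d_j}{\frac{\gamma_j}{1-\delta_j}+1}-\frac{\gamma_j}{1-\delta_j}\log_q\frac{q-d_j-1}{\frac{\gamma_j}{1-\delta_j}}\right].$$ For $0\le\alpha\le1$ let $\gamma=\alpha\gamma_0+(1-\alpha)\gamma_1$, $\delta=\alpha\delta_0+(1-\alpha)\delta_1$ and $r=\alpha r_0+(1-\alpha)r_1$. Then any $(\gamma,\delta)$-list-decodable family of $q$-ary codes has rate at most $r$.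
   Context: A $q$-ary insertion-deletion code of block length $n$ is a set $C\subseteq\Sigma^n$ with $|\Sigma|=q$. For $\gamma,\delta\ge 0$, it is $(\gamma,\delta,L)$-list-decodable if there is a function $D:\Sigma^*\to 2^C$ with $|D(w)|\le L$ for every $w\in\Sigma^*$, such that for every $x\in C$ and every word $w$ obtained from $x$ by at most $\gamma n$ insertions and at most $\delta n$ deletions, $x\in D(w)$. A family of $q$-ary codes $\mathcal{C}$ consists of codes $C_n$ with increasing block lengths $n$ (over an infinite set of lengths); it is $(\gamma,\delta)$-list-decodable if there is a polynomial function $L(\cdot)$ such that each $C_n$ is $(\gamma,\delta,L(n))$-list-decodable. The rate of the family is $R=\lim_{n\to\infty}\frac{\log_q|C_n|}{n}$. Conventions for degenerate values: when $\gamma_j=0$ the term $\frac{\gamma_j}{1-\delta_j}\log_q(\cdot)$ in $r_j$ is $0$; when $d_j=q-1$ and $\gamma_j>0$, $r_j=+\infty$; and $0\cdot(+\infty)=0$. *)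

(* Defs.v *)
From HB Require Import structures.
From mathcomp Require Import all_boot all_order all_algebra.
From mathcomp Require Import all_classical all_reals all_analysis.

Set Implicit Arguments.
Unset Strict Implicit.
Unset Printing Implicit Defensive.

Import Order.TTheory GRing.Theory Num.Theory.
Import numFieldNormedType.Exports.

Local Open Scope classical_set_scope.
Local Open Scope ring_scope.

(* [insdel x i d w]: w is obtained from x by exactly i single-symbol insertions
   and d single-symbol deletions, performed in any order. *)
Inductive insdel (T : Type) (x : seq T) : nat -> nat -> seq T -> Prop :=
| insdel_refl : insdel x 0 0 x
| insdel_ins i d u v a :
    insdel x i d (u ++ v) -> insdel x i.+1 d (u ++ a :: v)
| insdel_del i d u v a :
    insdel x i d (u ++ a :: v) -> insdel x i d.+1 (u ++ v).

Definition insdel_at_most (R : realType) (T : Type) (x : seq T) (a b : R)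
    (w : seq T) : Prop :=
  exists i d : nat, [/\ i%:R <= a, d%:R <= b & insdel x i d w].

(* The list-size bound L is a real number, so that it can be the value of a
   real polynomial. *)
Definition list_decodable (R : realType) (S : finType) (n : nat)
    (C : {set n.-tuple S}) (gamma delta L : R) : Prop :=
  exists D : seq S -> {set n.-tuple S},
    [/\ forall w, D w \subset C,
        forall w, #|D w|%:R <= L &
        forall (x : n.-tuple S) (w : seq S), x \in C ->
          insdel_at_most x (gamma * n%:R) (delta * n%:R) w -> x \in D w].

(* The infinite set of block lengths is enumerated in increasing order. *)
Record code_family (S : finType) := CodeFamily {
  blocklen : nat -> nat;
  blocklen_incr : {homo blocklen : i j / (i < j)%N};
  code : forall i : nat, {set (blocklen i).-tuple S}
}.

Definition family_list_decodable (R : realType) (S : finType)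
    (F : code_family S) (gamma delta : R) : Prop :=
  exists L : {poly R}, forall i : nat,
    list_decodable (code F i) gamma delta L.[(blocklen F i)%:R].

Definition logq (R : realType) (q : nat) (x : R) : R := ln x / ln q%:R.

(* [ln 0 = 0] and division by 0 gives 0, so an empty code or a code of block
   length 0 contributes the value 0 to the sequence. *)
Definition has_rate (R : realType) (S : finType) (F : code_family S)
    (rho : R) : Prop :=
  (fun i : nat => logq #|S| (#|code F i|%:R : R) / (blocklen F i)%:R)
    @ \oo --> rho.

(* The value +oo is the convention for log_q 0 = -oo, which occurs when
   d = q - 1 and g > 0. When g = 0 the subtracted term is 0 * logq _ = 0. *)
Definition rate_bound (R : realType) (q d : nat) (g : R) : \bar R :=
  let delta : R := d%:R / q%:R in
  let x : R := g / (1 - delta) in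
  if (d.+1 == q) && (0 < g) then +oo%E
  else ((1 - delta) *
        ((1 + x) * logq q ((q%:R - d%:R) / (x + 1))
         - x * logq q ((q%:R - d%:R - 1) / x)))%:E.

(* Main.v *)
Require Import Defs.
From HB Require Import structures.
From mathcomp Require Import all_boot all_order all_algebra.
From mathcomp Require Import all_classical all_reals all_analysis.
From mathcomp Require Import zify ring lra.

Set Implicit Arguments.
Unset Strict Implicit.
Unset Printing Implicit Defensive.

Import Order.TTheory GRing.Theory Num.Theory.
Import numFieldNormedType.Exports.

Local Open Scope ring_scope.

(* A codeword is cut at the fraction [alpha]. In each part the adversary deletes
   the [d_j] rarest symbols and inserts symbols of the remaining alphabet of
   size [k = q - d_j], so that the part becomes a word of length [m = N + M]
   over [k] letters; every such word containing the surviving subsequence, of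
   length [N], is reachable, and there are at least ['C(m, M) * (k - 1) ^ M] of
   them whatever the subsequence is. Counting the pairs (codeword, reachable
   word) bounds the code size by the list size times
   [k ^ m / ('C(m, M) * (k - 1) ^ M)] for each part, up to a polynomial factor,
   and the entropy approximation of the binomial coefficient turns this into
   [alpha * r_0 + (1 - alpha) * r_1]. *)

(** * Composition and concatenation of insertion-deletion derivations *)

Section InsdelTheory.
Variable T : Type.
Implicit Types x y z p w : seq T.

Lemma insdel_trans x y z i j d e :
  insdel x i d y -> insdel y j e z -> insdel x (j + i) (e + d) z.
Proof.
move=> xy; elim=> [//|{}j {}e u v a _ IH|{}j {}e u v a _ IH]; rewrite addSn.
  exact: insdel_ins.
by apply: insdel_del IH.
Qed.

Lemma insdel_prepend p x i d w : insdel x i d w -> insdel (p ++ x) i d (p ++ w).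
Proof.
elim=> [|{}i {}d u v a _ IH|{}i {}d u v a _ IH]; first exact: insdel_refl.
  by rewrite catA; apply: insdel_ins; rewrite -catA.
by rewrite catA; apply: (@insdel_del _ _ _ _ _ _ a); rewrite -catA.
Qed.

Lemma insdel_append p x i d w : insdel x i d w -> insdel (x ++ p) i d (w ++ p).
Proof.
elim=> [|{}i {}d u v a _ IH|{}i {}d u v a _ IH]; first exact: insdel_refl.
  by rewrite -catA; apply: insdel_ins; rewrite catA.
by rewrite -catA; apply: (@insdel_del _ _ _ _ _ _ a); rewrite -cat_cons catA.
Qed.

Lemma insdel_cat x1 x2 i1 i2 d1 d2 w1 w2 : insdel x1 i1 d1 w1 ->
  insdel x2 i2 d2 w2 -> insdel (x1 ++ x2) (i1 + i2) (d1 + d2) (w1 ++ w2).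
Proof.
move=> h1 h2; rewrite addnC (addnC d1).
exact: insdel_trans (insdel_append x2 h1) (insdel_prepend w1 h2).
Qed.

End InsdelTheory.

Section SubseqInsdel.
Variable T : eqType.
Implicit Types x y z w : seq T.

Lemma subseq_del_ins z w : subseq z w ->
  insdel w 0 (size w - size z) z /\ insdel z (size w - size z) 0 w.
Proof.
elim: w z => [|a w IH] [|b z] //=; first by split; apply: insdel_refl.
- move=> _; have [h1 h2] := IH [::] (sub0seq _).
  rewrite /= !subn0 in h1 h2 *; split.
    apply: (@insdel_del _ _ _ _ [::] [::] a) => /=.
    exact: (insdel_prepend [:: a] h1).
  exact: (@insdel_ins _ _ _ _ [::]).
- case: eqP => [-> /IH[h1 h2]|_ sub].
    rewrite subSS; split; first exact: (insdel_prepend [:: a] h1).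
    exact: (insdel_prepend [:: a] h2).
  have [h1 h2] := IH _ sub; have /= := size_subseq sub => le_zw.
  rewrite subSn //; split; last exact: (@insdel_ins _ _ _ _ [::]).
  apply: (@insdel_del _ _ _ _ [::] (b :: z) a) => /=.
  exact: (insdel_prepend [:: a] h1).
Qed.

End SubseqInsdel.

(** * Counting words over a subalphabet *)

Lemma count_allpairs (T1 T2 U : Type) (f : T1 -> T2 -> U) (P : pred U) s t :
  count P [seq f a b | a <- s, b <- t] =
  (\sum_(a <- s) count (fun b => P (f a b)) t)%N.
Proof.
elim: s => [|a s IH]; first by rewrite big_nil.
by rewrite /= count_cat IH big_cons count_map.
Qed.

Fixpoint words (T : Type) (A : seq T) (m : nat) : seq (seq T) :=
  if m is m'.+1 then [seq a :: w | a <- A, w <- words A m'] else [:: [::]].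

Lemma size_words (T : Type) (A : seq T) m : size (words A m) = (size A ^ m)%N.
Proof. by elim: m => [//|m IH] /=; rewrite size_allpairs IH expnS. Qed.

Lemma mem_words (T : eqType) (A w : seq T) :
  all (mem A) w -> w \in words A (size w).
Proof.
elim: w => [//|a w IH] /= /andP[aA /IH ww].
exact: (allpairs_f (fun a w => a :: w)).
Qed.

(* The number of length-[m] words containing [z] as a subsequence depends only
   on [size z]; splitting on the first letter gives Pascal's recursion. *)
Lemma count_subseq_words (T : eqType) (A z : seq T) M m :
  uniq A -> all (mem A) z -> (size z + M = m)%N ->
  ('C(m, M) * (size A).-1 ^ M <= count (subseq z) (words A m))%N.
Proof.
move=> uA; elim: m M z => [|m IH] M z Az szM.
  have M0 : M = 0%N by lia.
  have /size0nil -> : size z = 0%N by lia.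
  by rewrite M0.
(* For empty [z] every word counts; the bound keeps only the last term of the binomial expansion of
   [((size A).-1 + 1) ^ m.+1]. *)
case: z Az szM => [|y z] Az szM.
  rewrite (eq_count (a2 := predT)); last by move=> w; rewrite sub0seq.
  have -> : M = m.+1 by rewrite -szM.
  by rewrite count_predT size_words binn mul1n leq_exp2r // leq_pred.
move: (Az) => /= /andP[yA Az'].
(* A tail after the first letter [y] must contain [z]; after any of the other [(size A).-1] letters
   it must still contain all of [y :: z]. *)
rewrite [words _ _]/= count_allpairs (big_rem y) //=.
have -> : (\sum_(a <- rem y A) count (subseq (if y == a then z else y :: z))
    (words A m) =
    (size A).-1 * count (subseq (y :: z)) (words A m))%N.
  rewrite (eq_big_seq (fun=> count (subseq (y :: z)) (words A m))).
    by rewrite big_const_seq count_predT iter_addn_0 size_rem // mulnC.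
  move=> a; rewrite mem_rem_uniq // inE => /andP[/negPf ay _].
  by rewrite eq_sym ay.
rewrite eqxx.
case: M szM => [|M] szM.
  have := IH 0%N z Az'; rewrite !bin0 !expn0 => h.
  by apply: leq_trans (h _) (leq_addr _ _); move: szM => /=; lia.
rewrite binS mulnDl leq_add //; first by apply: IH => //; move: szM => /=; lia.
rewrite expnS mulnCA leq_mul2l; apply/orP; right.
by apply: IH => //; move: szM => /=; lia.
Qed.

(** The deleted letters depend on the codeword, but double counting needs one list of targets for
    all codewords. Running over all [k]-subsets of the alphabet costs only the factor ['C(#|S|, k)],
    which does not depend on [m]. Repetitions are kept, so the size is an exact product. *)
Definition sparse_words (S : finType) (k m : nat) : seq (seq S) :=
  flatten [seq words (enum A) m | A : {set S} <- enum [set A : {set S} | #|A| == k]].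

Lemma size_sparse_words (S : finType) k m :
  size (sparse_words S k m) = ('C(#|S|, k) * k ^ m)%N.
Proof.
rewrite /sparse_words size_flatten /shape sumnE !big_map big_enum /=.
rewrite (eq_bigr (fun=> k ^ m)%N) => [|A]; last first.
  by rewrite inE => /eqP <-; rewrite size_words -cardE.
by rewrite sum_nat_const card_draws.
Qed.

Lemma leq_count_sparse_words (S : finType) (A : {set S}) m (P : pred (seq S)) :
  (count P (words (enum A) m) <= count P (sparse_words S #|A| m))%N.
Proof.
rewrite /sparse_words count_flatten -map_comp sumnE big_map.
by rewrite (big_rem A) ?mem_enum ?inE //= leq_addr.
Qed.

(** Greedy choice: the rarest letter outside [B] occurs at most as often as the average letter
    outside [B]. *)
Lemma rare_letters (S : finType) (y : seq S) d : (d <= #|S|)%N ->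
  exists B : {set S}, #|B| = d /\
    (#|S| * count (mem B) y <= d * size y)%N.
Proof.
elim: d => [_|d IH lt_dS].
  exists finset.set0; rewrite cards0; split=> //.
  by rewrite (eq_count (a2 := pred0)) ?count_pred0 ?muln0 // => a /=; rewrite inE.
have [B [cB hB]] := IH (ltnW lt_dS).
have cBC : (#|~: B| = #|S| - d)%N by rewrite -cB -(cardsC B) addKn.
have [b0 b0B] : exists b, b \in ~: B by apply/card_gt0P; rewrite cBC subn_gt0.
pose b := [arg min_(b < b0 in ~: B) count_mem b y].
have [bB bmin] : b \in ~: B /\
    forall a, a \in ~: B -> (count_mem b y <= count_mem a y)%N.
  by rewrite /b; case: arg_minnP.
exists (b |: B); split; first by move: bB; rewrite !inE => bB; rewrite cardsU1 bB cB.
have cntU : count (mem (b |: B)) y = (count_mem b y + count (mem B) y)%N.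
  rewrite -(count_predUI (pred1 b)).
  rewrite [X in (_ + X)%N](eq_count (a2 := pred0)) ?count_pred0 ?addn0.
    by apply: eq_count => a; rewrite /= !inE.
  move=> a /=; apply/negbTE/negP => /andP[/eqP -> bB'].
  by move: bB; rewrite inE; rewrite -topredE /= in bB' *; rewrite bB'.
have sumC : (\sum_(a in ~: B) count_mem a y + count (mem B) y = size y)%N.
  rewrite -(count_predC (mem B) y) addnC; congr addn.
  elim: y {IH b bB bmin hB cntU} => [|a y IHy] /=; first by rewrite big1.
  rewrite big_split /= IHy; congr addn.
  have [aB|aB] := boolP (a \in ~: B).
    rewrite (bigD1 a) //= eqxx big1 ?addn0; last first.
      by move=> c /andP[_ /negPf]; rewrite eq_sym => ->.
    by move: aB; rewrite inE => ->.
  rewrite big1; first by move: aB; rewrite inE negbK => ->.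
  by move=> c cB'; case: eqP => // ac; rewrite ac cB' in aB.
have minC : ((#|S| - d) * count_mem b y <= \sum_(a in ~: B) count_mem a y)%N.
  by rewrite -cBC -sum_nat_const; apply: leq_sum => a /bmin.
(* Write [q] for [#|S|], [u] and [v] for the occurrences of [b] and of [B], and [n] for the length.
   From [(q - d) u <= n - v] and [q v <= d n] follows [q (q - d) (u + v) <= q n + (q - d - 1) q v <=
   (q - d) (d + 1) n]. *)
rewrite cntU -(leq_pmul2l (m := (#|S| - d)%N)); last by rewrite subn_gt0.
move: minC sumC hB.
move: (count_mem b y) (count _ y) (\sum_(_ in _) _)%N (size y) => u v s n.
have [k ek] : exists k, (#|S| = d + k.+1)%N by exists (#|S| - d.+1)%N; lia.
by rewrite ek addKn; clear; move=> h1 h2 h3; nia.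
Qed.

(** * Reachable words and double counting *)

(* The words are counted with multiplicity, so that double counting needs no
   duplicate-freeness of [W]. *)
Definition reaches (T : Type) (x : seq T) (i d : nat) (W : seq (seq T))
    (N : nat) : Prop :=
  (N <= count (fun w => `[< insdel x i d w >]) W)%N.

Lemma reaches_cat (T : Type) (x1 x2 : seq T) i1 i2 d1 d2 W1 W2 N1 N2 :
  reaches x1 i1 d1 W1 N1 -> reaches x2 i2 d2 W2 N2 ->
  reaches (x1 ++ x2) (i1 + i2) (d1 + d2) [seq w1 ++ w2 | w1 <- W1, w2 <- W2]
    (N1 * N2).
Proof.
rewrite /reaches => h1 h2; apply: leq_trans (leq_mul h1 h2) _.
rewrite count_allpairs; elim: W1 {h1 h2} => [|w W1 IH]; first by rewrite big_nil.
rewrite /= big_cons mulnDl leq_add //.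
case: asboolP => [hw|_]; last by [].
rewrite mul1n; apply: sub_count => w2 /= /asboolP h2; apply/asboolP.
exact: insdel_cat.
Qed.

(** Meant for the symbols left over by rounding the cut: they stay unedited, at the price of
    allowing every word of their length as target. *)
Lemma reaches_id (S : finType) (x : seq S) :
  reaches x 0 0 (words (enum S) (size x)) 1.
Proof.
rewrite /reaches -has_count; apply/hasP; exists x; last exact/asboolP/insdel_refl.
by apply: mem_words; apply/allP => a _; rewrite /= mem_enum.
Qed.

(* Delete the [d] rarest symbols, trim to a fixed length, then insert. *)
Lemma reaches_sparse (S : finType) d M (x : seq S) : (d < #|S|)%N ->
  let e := (size x * d %/ #|S|)%N in let m := (size x - e + M)%N in
  reaches x M e (sparse_words S (#|S| - d) m)
    ('C(m, M) * (#|S| - d).-1 ^ M).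
Proof.
move=> dS e m; have [B [cB hB]] := rare_letters x (ltnW dS).
have cBC : (#|~: B| = #|S| - d)%N by rewrite -cB -(cardsC B) addKn.
have ex : (e <= size x)%N.
  rewrite -[leqRHS](mulnK _ (leq_ltn_trans (leq0n d) dS)).
  by rewrite leq_div2r // leq_mul2l (ltnW dS) orbT.
pose z := take (size x - e) [seq a <- x | a \in ~: B].
have sz : size z = (size x - e)%N.
  rewrite size_takel // size_filter.
  have /= <- : count (predC (mem B)) x = count (fun a => a \in ~: B) x.
    by apply: eq_count => a; rewrite /= inE.
  have -> : count (predC (mem B)) x = (size x - count (mem B) x)%N.
    by rewrite -(count_predC (mem B) x) addKn.
  (* The floor in [e] is harmless: the number of rare letters is an integer bounded by the unrounded
     quotient. *)
  rewrite leq_sub2l // /e leq_divRL ?(leq_ltn_trans _ dS) //.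
  by rewrite mulnC [(size x * d)%N]mulnC.
have zB : all (mem (enum (~: B))) z.
  apply/allP => a /mem_take; rewrite mem_filter => /andP[aB _].
  by rewrite /= mem_enum.
have zx : subseq z x by apply: subseq_trans (take_subseq _ _) (filter_subseq _ _).
rewrite /reaches -cBC.
have := @count_subseq_words _ (enum (~: B)) z M m (enum_uniq _) zB.
rewrite -cardE sz => /(_ erefl) h; apply: leq_trans h _.
apply: leq_trans (leq_count_sparse_words _ _ _).
have wordsz w : w \in words (enum (~: B)) m -> size w = m.
  elim: {z zB zx sz} m w => [|m' IH] w /=; first by rewrite inE => /eqP ->.
  by case/allpairsP => -[a v] /= [_ /IH <- ->].
(* The length has to be part of the predicate, because the number of insertions is [size w - size z]
   and must come out as exactly [M]. *)
rewrite (eq_in_count (a2 := fun w => (size w == m) && subseq z w)); last first.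
  by move=> w /wordsz ->; rewrite eqxx.
apply: sub_count => w /andP[/eqP sw zw]; apply/asboolP.
have [_ ins] := subseq_del_ins zw; have [del _] := subseq_del_ins zx.
have := insdel_trans del ins.
by rewrite sz sw addn0 add0n subKn // /m addKn.
Qed.

(** The pairs [(x, w)] with [x \in D w] number at least [N] per codeword, by reachability, and at
    most [L] per entry of [W]. *)
Lemma list_decodable_count (R : realType) (S : finType) n
    (C : {set n.-tuple S}) (gamma delta L : R) i d W N :
  list_decodable C gamma delta L ->
  i%:R <= gamma * n%:R -> d%:R <= delta * n%:R ->
  (forall x : n.-tuple S, x \in C -> reaches x i d W N) ->
  (#|C| * N)%:R <= L * (size W)%:R.
Proof.
case=> D [DC DL Dx] ile dle reach.
have : (#|C| * N <= \sum_(w <- W) #|D w|)%N.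
  rewrite -sum_nat_const.
  apply: (@leq_trans (\sum_(x in C) \sum_(w <- W) (x \in D w))%N).
    apply: leq_sum => x xC; apply: leq_trans (reach x xC) _.
    rewrite -sum1_count big_mkcond leq_sum // => w _.
    by case: asboolP => // hw; rewrite Dx //; exists i, d.
  rewrite exchange_big leq_sum //= => w _.
  rewrite -sum1_card [leqRHS]big_mkcond /= [leqLHS]big_mkcond.
  by apply: leq_sum => x _; case: (x \in C); case: (x \in D w).
rewrite -(ler_nat R) => /le_trans; apply.
rewrite natr_sum mulr_natr -[size W]count_predT -iter_addr_0 -big_const_seq.
by apply: ler_sum => w _; apply: DL.
Qed.

(** * Entropy estimate of the binomial coefficient *)

(** The binomial expansion of the left side has [(N + M).+1] terms, the largest of which is the one
    of index [M]. *)
Lemma max_binomial_term N M :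
  ((N + M) ^ (N + M) <= (N + M).+1 * ('C(N + M, M) * (N ^ N * M ^ M)))%N.
Proof.
pose t i := ('C(N + M, i) * (N ^ (N + M - i) * M ^ i))%N.
(* Ratio of consecutive terms, cross-multiplied: [t] does not decrease up to index [M] and does not
   increase after it. *)
have step i : (i < N + M)%N -> (t i.+1 * (i.+1 * N) = t i * ((N + M - i) * M))%N.
  move=> im; have := mul_bin_left (N + M) i; rewrite /t.
  have [j ej] : exists j, (N + M - i = j.+1)%N by exists (N + M - i).-1; lia.
  have -> : (N + M - i.+1 = j)%N by lia.
  rewrite ej !expnS => h.
  by transitivity (i.+1 * 'C(N + M, i.+1) * (N * N ^ j * (M * M ^ i)))%N; [|rewrite h]; ring.
have le_t i : (i <= N + M)%N -> (t i <= t M)%N.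
  have [iM _|Mi] := leqP i M.
    have down j : (j <= M)%N -> (t (M - j) <= t M)%N.
      elim: j => [|j IH] jM; first by rewrite subn0.
      apply: leq_trans (IH (ltnW jM)).
      have -> : (M - j = (M - j.+1).+1)%N by lia.
      have uM : (M - j.+1 < M)%N by lia.
      move: (M - j.+1)%N uM => u uM {IH jM}.
      (* For [N = 0] the ratio cannot be cancelled, but then [t u] contains a positive power of
         0. *)
      have [N0|N0] := posnP N.
        by rewrite /t N0 exp0n ?mul0n ?muln0 //; lia.
      rewrite -(leq_pmul2r (m := (u.+1 * N)%N)) ?muln_gt0 //.
      rewrite step; last by lia.
      rewrite leq_mul2l mulnC leq_mul ?orbT //; lia.
    by rewrite -(subKn iM) down // leq_subr.
  rewrite -(subnKC (ltnW Mi)); elim: (i - M)%N => [|j IH]; first by rewrite addn0.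
  move=> h; apply: leq_trans (IH _); last by lia.
  have N0 : (0 < N)%N by lia.
  rewrite addnS -(leq_pmul2r (m := ((M + j).+1 * N)%N)) ?muln_gt0 //.
  rewrite step; last by lia.
  by rewrite leq_mul2l [leqLHS]mulnC leq_mul ?orbT //; lia.
rewrite {1}expnDn -[X in (_ <= X * _)%N]card_ord -sum_nat_const.
apply: leq_sum => i _; have := le_t i (leq_ord i).
by rewrite /t addnK.
Qed.

Lemma binomial_term_le k N M :
  ('C(N + M, M) * k ^ M <= k.+1 ^ (N + M))%N.
Proof.
rewrite -add1n expnDn (bigD1 (inord M)) //= inordK ?ltnS ?leq_addl //.
by rewrite exp1n mul1n leq_addr.
Qed.

Lemma ln_natM (R : realType) a b : (0 < a)%N -> (0 < b)%N ->
  ln ((a * b)%:R : R) = ln a%:R + ln b%:R.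
Proof. by move=> a0 b0; rewrite natrM lnM // posrE ltr0n. Qed.

(** At 0 the value is 0, which is the continuous extension and agrees with [0 ^ 0 = 1] in
    [xlnxE]. *)
Definition xlnx (R : realType) (t : R) : R := t * ln t.

Lemma xlnxE (R : realType) n : xlnx (n%:R : R) = ln ((n ^ n)%:R).
Proof.
case: n => [|n]; first by rewrite /xlnx mul0r ln1.
by rewrite natrX lnXn ?ltr0Sn // /xlnx mulr_natl.
Qed.

(* The logarithm of the ratio of [k ^ m] to the entropy approximation of
   ['C(m, M) * (k - 1) ^ M], where [m = N + M]. *)
Definition block_cost (R : realType) (k : nat) (N M : R) : R :=
  (N + M) * ln k%:R - M * ln (k%:R - 1) - xlnx (N + M) + xlnx N + xlnx M.

(** This is the logarithm of [max_binomial_term]. For [k = 1] the factor [k.-1 ^ M] vanishes unless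
    [M = 0], hence the second hypothesis. *)
Lemma block_cost_ge (R : realType) k N M :
  (0 < k)%N -> (k == 1)%N ==> (M == 0)%N ->
  ln ((k ^ (N + M))%:R : R) <=
    ln (('C(N + M, M) * k.-1 ^ M)%:R) + ln ((N + M).+1%:R)
    + block_cost k N%:R M%:R.
Proof.
case: k => // k _ kM; rewrite [_.-1]/=.
have kM0 : (0 < k ^ M)%N by rewrite expn_gt0; move: kM; case: (k) => //= /eqP ->.
have C0 : (0 < 'C(N + M, M))%N by rewrite bin_gt0 leq_addl.
have NM0 a : (0 < a ^ a)%N by rewrite expn_gt0; case: a.
have lnk : ln ((k ^ M)%:R : R) = M%:R * ln k%:R.
  have [k0|k0] := posnP k; last by rewrite natrX lnXn ?ltr0n // mulr_natl.
  by move: kM; rewrite k0 => /eqP ->; rewrite mul0r ln1.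
have -> : ln ((k.+1 ^ (N + M))%:R : R) = (N + M)%:R * ln k.+1%:R.
  by rewrite natrX lnXn ?ltr0Sn // mulr_natl.
rewrite /block_cost -natrD -[k.+1%:R]natr1 addrK !xlnxE.
have : ln ((N + M) ^ (N + M))%:R <=
    ln ((N + M).+1 * ('C(N + M, M) * (N ^ N * M ^ M)))%:R :> R.
  rewrite ler_ln ?posrE ?ltr0n ?muln_gt0 ?C0 ?NM0 //.
  by rewrite ler_nat max_binomial_term.
rewrite !ln_natM ?muln_gt0 ?C0 ?NM0 // lnk; lra.
Qed.

(** * Code size at a fixed block length *)

(** The codeword is cut into two edited parts and a remainder of at most one symbol. Replacing [L]
    by some [K >= 1] makes the bound survive an empty code. *)
Lemma code_size_bound (R : realType) (S : finType) n (C : {set n.-tuple S})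
    (gamma delta L K : R) d0 d1 n0 n1 M0 M1 :
  let e0 := (n0 * d0 %/ #|S|)%N in
  let e1 := (n1 * d1 %/ #|S|)%N in
  let k0 := (#|S| - d0)%N in
  let k1 := (#|S| - d1)%N in
  let N0 := (n0 - e0)%N in
  let N1 := (n1 - e1)%N in
  (1 < #|S|)%N -> (d0 < #|S|)%N -> (d1 < #|S|)%N ->
  (k0 == 1)%N ==> (M0 == 0)%N -> (k1 == 1)%N ==> (M1 == 0)%N ->
  (n0 + n1 <= n <= (n0 + n1).+1)%N ->
  (M0 + M1)%:R <= gamma * n%:R -> (e0 + e1)%:R <= delta * n%:R ->
  list_decodable C gamma delta L -> L <= K -> 1 <= K ->
  ln (#|C|%:R : R) <=
    ln K + ln ('C(#|S|, k0) * 'C(#|S|, k1) * #|S|)%:R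
    + (ln (N0 + M0).+1%:R + block_cost k0 N0%:R M0%:R)
    + (ln (N1 + M1).+1%:R + block_cost k1 N1%:R M1%:R).
Proof.
move=> e0 e1 k0 k1 N0 N1 S1 dS0 dS1 kM0 kM1 /andP[len leS] ins del dec LK K1.
pose c := (n - (n0 + n1))%N.
pose s k N M := ('C(N + M, M) * k.-1 ^ M)%N.
pose W0 := sparse_words S k0 (N0 + M0).
pose W1 := sparse_words S k1 (N1 + M1).
pose W2 := words (enum S) c.
pose W := [seq w0 ++ w12 | w0 <- W0, w12 <- [seq w1 ++ w2 | w1 <- W1, w2 <- W2]].
have reach (x : n.-tuple S) : x \in C ->
    reaches x (M0 + M1) (e0 + e1) W (s k0 N0 M0 * s k1 N1 M1).
  move=> _; have sx : size x = n by rewrite size_tuple.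
  rewrite -{1}(cat_take_drop n0 x) -{1}(cat_take_drop n1 (drop n0 x)).
  have s0 : size (take n0 x) = n0 by rewrite size_takel // sx; lia.
  have s1 : size (take n1 (drop n0 x)) = n1 by rewrite size_takel // size_drop sx; lia.
  have s2 : size (drop n1 (drop n0 x)) = c by rewrite !size_drop sx; lia.
  have := reaches_sparse M0 (take n0 x) dS0.
  have := reaches_sparse M1 (take n1 (drop n0 x)) dS1.
  have := reaches_id (drop n1 (drop n0 x)).
  rewrite /= s0 s1 s2 => r2 r1 r0.
  have := reaches_cat r0 (reaches_cat r1 r2).
  by rewrite !addn0 muln1.
have := list_decodable_count dec ins del reach.
have sW : size W =
    ('C(#|S|, k0) * k0 ^ (N0 + M0) * ('C(#|S|, k1) * k1 ^ (N1 + M1) * #|S| ^ c))%N.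
  by rewrite !size_allpairs !size_sparse_words size_words -cardE.
have kpos0 : (0 < k0)%N by rewrite subn_gt0.
have kpos1 : (0 < k1)%N by rewrite subn_gt0.
have spos k N M : (0 < k)%N -> (k == 1)%N ==> (M == 0)%N -> (0 < s k N M)%N.
  move=> k0' kM; rewrite muln_gt0 bin_gt0 leq_addl expn_gt0 /=.
  by move: kM k0'; case: (k) => [|[|?]] //= /eqP ->.
have bpos k : (k <= #|S|)%N -> (0 < 'C(#|S|, k))%N by rewrite bin_gt0.
have sle k N M : (0 < k)%N -> (s k N M <= k ^ (N + M))%N.
  by case: k => // k _; apply: binomial_term_le.
set B := ('C(#|S|, k0) * 'C(#|S|, k1) * #|S|)%N.
have B0 : (0 < B)%N by rewrite !muln_gt0 !bpos ?leq_subr //= ltnW.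
(* The unedited remainder has length at most 1, so it contributes at most a factor [#|S|]. *)
have sWle : (size W <= B * (k0 ^ (N0 + M0) * k1 ^ (N1 + M1)))%N.
  rewrite sW /B.
  have Sc : (#|S| ^ c <= #|S|)%N.
    by rewrite -[leqRHS]expn1 leq_exp2l // leq_subLR addn1.
  have -> : ('C(#|S|, k0) * k0 ^ (N0 + M0) * ('C(#|S|, k1) * k1 ^ (N1 + M1) * #|S| ^ c) =
      'C(#|S|, k0) * 'C(#|S|, k1) * #|S| ^ c * (k0 ^ (N0 + M0) * k1 ^ (N1 + M1)))%N by ring.
  by rewrite !leq_mul.
move=> main.
(* Since [ln 0 = 0 = ln 1], an empty code is treated as one of size 1; the inequality then reduces
   to [binomial_term_le] and [K >= 1]. *)
have key : ((maxn 1 #|C|) * (s k0 N0 M0 * s k1 N1 M1))%:R <=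
    K * (B * (k0 ^ (N0 + M0) * k1 ^ (N1 + M1)))%:R.
  have [C0|C0] := posnP #|C|.
    rewrite C0 mul1n; apply: (@le_trans _ _ (B * (k0 ^ (N0 + M0) * k1 ^ (N1 + M1)))%:R).
      rewrite ler_nat; apply: leq_trans (leq_pmull _ B0).
      by apply: leq_mul; apply: sle.
    by rewrite ler_peMl.
  rewrite (maxn_idPr C0); apply: le_trans main _.
  apply: (@le_trans _ _ (K * (size W)%:R)); first by rewrite ler_wpM2r.
  by rewrite ler_wpM2l ?ler_nat //; apply: le_trans K1.
have -> : ln (#|C|%:R : R) = ln (maxn 1 #|C|)%:R.
  by have [->|C0] := posnP #|C|; [rewrite ln0 ?ln1|rewrite (maxn_idPr C0)].
have K0 : 0 < K by apply: lt_le_trans K1.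
have m0 : (0 < maxn 1 #|C|)%N by rewrite leq_max.
have kk0 : (0 < k0 ^ (N0 + M0))%N by rewrite expn_gt0 kpos0.
have kk1 : (0 < k1 ^ (N1 + M1))%N by rewrite expn_gt0 kpos1.
have s0pos := spos _ N0 _ kpos0 kM0; have s1pos := spos _ N1 _ kpos1 kM1.
have : ln (maxn 1 #|C| * (s k0 N0 M0 * s k1 N1 M1))%:R <=
    ln (K * (B * (k0 ^ (N0 + M0) * k1 ^ (N1 + M1)))%:R).
  rewrite ler_ln // posrE.
    by rewrite ltr0n muln_gt0 m0 muln_gt0 s0pos s1pos.
  by rewrite mulr_gt0 // ltr0n muln_gt0 B0 muln_gt0 kk0 kk1.
have Bkk : (0 < B * (k0 ^ (N0 + M0) * k1 ^ (N1 + M1)))%N.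
  by rewrite muln_gt0 B0 muln_gt0 kk0 kk1.
rewrite lnM ?posrE ?ltr0n //.
have ss : (0 < s k0 N0 M0 * s k1 N1 M1)%N by rewrite muln_gt0 s0pos.
have kk : (0 < k0 ^ (N0 + M0) * k1 ^ (N1 + M1))%N by rewrite muln_gt0 kk0.
rewrite (ln_natM _ m0 ss) (ln_natM _ s0pos s1pos) (ln_natM _ B0 kk).
rewrite (ln_natM _ kk0 kk1).
have := block_cost_ge R N0 kpos0 kM0; have := block_cost_ge R N1 kpos1 kM1.
rewrite -/(s k0 N0 M0) -/(s k1 N1 M1); lra.
Qed.

(** * Homogeneity and continuity of the block cost *)

Section Limits.
Local Open Scope classical_set_scope.
Variable R : realType.
Implicit Types (b c t N M g : R) (k q d : nat).

Lemma xlnxM c t : 0 <= c -> 0 <= t -> xlnx (c * t) = c * xlnx t + t * xlnx c.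
Proof.
rewrite /xlnx !le_eqVlt => /predU1P[<-|c0]; first by rewrite !mul0r mulr0 addr0.
move=> /predU1P[<-|t0]; first by rewrite !(mul0r, mulr0) addr0.
by rewrite lnM ?posrE //; ring.
Qed.

(** The correction terms [t * xlnx c] of [xlnxM] cancel between [N + M], [N] and [M]. Dividing the
    cost by the block length thus only rescales its arguments. *)
Lemma block_costM k c N M : 0 <= c -> 0 <= N -> 0 <= M ->
  block_cost k (c * N) (c * M) = c * block_cost k N M.
Proof.
move=> c0 N0 M0; rewrite /block_cost -mulrDr !xlnxM ?addr_ge0 //; ring.
Qed.

(** At 0, [ln y < y] for [y] the inverse square root of [x] traps [xlnx x] between multiples of
    [Num.sqrt x]. *)
Lemma xlnx_continuous t : 0 <= t -> {for t, continuous (@xlnx R)}.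
Proof.
rewrite le_eqVlt => /predU1P[<-|t0]; last first.
  by apply: cvgM; [exact: cvg_id|exact: continuous_ln].
rewrite /prop_for /continuous_at {2}/xlnx mul0r.
have sqrt0 (b : R) : b * Num.sqrt x @[x --> (0 : R)] --> (0 : R).
  rewrite -[X in _ --> X](mulr0 b) -[X in _ --> b * X]sqrtr0.
  by apply: cvgMl_tmp; exact: sqrt_continuous.
apply: (@squeeze_cvgr _ _ _ _ (fun x => - 2 * Num.sqrt x) (fun x => 2 * Num.sqrt x));
  [|exact: sqrt0|exact: sqrt0].
near=> x.
have x1 : x < 1 by near: x; apply: lt_nbhsl; exact: ltr01.
(* To the left of 0 both [ln] and [Num.sqrt] take the default value 0. *)
have [x0|x0] := leP x 0; first by rewrite /xlnx ln0 // mulr0 ler0_sqrtr // !mulr0 lexx.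
have s0 : 0 < Num.sqrt x by rewrite sqrtr_gt0.
have xE : x = Num.sqrt x ^+ 2 by rewrite sqr_sqrtr // ltW.
have lnx0 : ln x <= 0 by rewrite ln_le0 // ltW.
have := @ln_sublinear R (Num.sqrt x)^-1; rewrite invr_gt0 => /(_ s0).
rewrite lnV ?posrE // => h.
have lnE : ln x = ln (Num.sqrt x) *+ 2 by rewrite {1}xE lnXn.
have sV : Num.sqrt x * (Num.sqrt x)^-1 = 1 by rewrite mulfV // gt_eqF.
have -> : xlnx x = - 2 * (Num.sqrt x * (Num.sqrt x * - ln (Num.sqrt x))).
  by rewrite /xlnx lnE {1}xE; ring.
rewrite lnE in lnx0.
move: (Num.sqrt x) (ln _) (_^-1) s0 h sV lnx0 => s l v s0 h sV l0.
have h2 : s * - l <= s * v by rewrite ler_pM2l // ltW.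
have h3 : 0 <= s * - l by rewrite mulr_ge0 ?(ltW s0) //; lra.
have h4 : 0 <= s * (s * - l) <= s * 1.
  by rewrite mulr_ge0 ?(ltW s0) //= ler_pM2l // -sV.
by move/andP: h4 => [h4 h5]; apply/andP; split; lra.
Unshelve. all: by end_near. Qed.

Lemma cvg_block_cost k (u v : nat -> R) N M : 0 <= N -> 0 <= M ->
  u @ \oo --> N -> v @ \oo --> M ->
  block_cost k (u n) (v n) @[n --> \oo] --> block_cost k N M.
Proof.
move=> N0 M0 uN vM; have uv := cvgD uN vM.
have xl w (l : R) : 0 <= l -> w n @[n --> \oo] --> l -> xlnx (w n) @[n --> \oo] --> xlnx l.
  by move=> l0 wl; apply: continuous_cvg => //; exact: xlnx_continuous.
apply: cvgD; last exact: xl.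
apply: cvgD; last exact: xl.
apply: cvgB; last by apply: (xl _ _ (addr_ge0 N0 M0)); exact: uv.
by apply: cvgB; [apply: cvgMr_tmp; exact: uv|apply: cvgMr_tmp; exact: vM].
Qed.

Lemma cvg_natV : (n%:R^-1 : R) @[n --> \oo] --> 0.
Proof.
apply/(@gtr0_cvgV0 _ _ _ _ (fun n => n%:R : R)); last exact: cvgr_idn.
by near=> n; rewrite ltr0n; near: n; exists 1%N.
Unshelve. all: by end_near. Qed.

Lemma cvg_ln_nat : (ln n%:R / n%:R : R) @[n --> \oo] --> 0.
Proof.
have -> : (fun n => ln n%:R / n%:R) = (fun n => - xlnx (n%:R^-1 : R)).
  apply/funext => -[|n]; first by rewrite /xlnx invr0 mulr0 mul0r oppr0.
  by rewrite /xlnx lnV ?posrE // mulrN opprK mulrC.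
rewrite -oppr0 -[X in - X](mul0r (ln 0)); apply: cvgN.
apply: continuous_cvg (cvg_natV); exact: xlnx_continuous.
Qed.

Lemma cvg_rounding (u : nat -> nat) (a : R) :
  (forall n, `|(u n)%:R - a * n%:R| <= 1) -> (u n)%:R / n%:R @[n --> \oo] --> a.
Proof.
move=> ua.
apply: (@squeeze_cvgr _ _ _ _ (fun n => a - n%:R^-1) (fun n => a + n%:R^-1)).
- near=> n; have n0 : 0 < n%:R :> R by rewrite ltr0n; near: n; exists 1%N.
  have := ua n; rewrite ler_norml => /andP[h1 h2].
  rewrite ler_pdivlMr // ler_pdivrMr // mulrBl mulrDl mulVf ?gt_eqF //.
  by apply/andP; split; lra.
- by rewrite -[X in _ --> X]subr0; apply: cvgB; [exact: cvg_cst|exact: cvg_natV].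
- by rewrite -[X in _ --> X]addr0; apply: cvgD; [exact: cvg_cst|exact: cvg_natV].
Unshelve. all: by end_near. Qed.

(** * Rounded lengths and the limit of the block cost *)

Definition piece (b : R) (n : nat) : nat := Num.truncn (b * n%:R).

Definition kept (q d : nat) (b : R) (n : nat) : nat :=
  (piece b n - piece b n * d %/ q)%N.

Lemma piece_itv b n : 0 <= b -> (piece b n)%:R <= b * n%:R < (piece b n)%:R + 1.
Proof. by move=> b0; rewrite natr1; apply: truncn_itv; rewrite mulr_ge0. Qed.

(** Rounding the part down shortens what is kept, rounding the deletions down lengthens it. The two
    errors have opposite signs and are each at most 1, so their sum is too. *)
Lemma kept_itv q d b n : (d < q)%N -> 0 <= b ->
  `|(kept q d b n)%:R - b * (1 - d%:R / q%:R) * n%:R| <= 1.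
Proof.
move=> dq b0; rewrite /kept; have /andP[] := piece_itv n b0.
have q0 : (0 < q)%N by apply: leq_ltn_trans dq.
have q0' : 0 < q%:R :> R by rewrite ltr0n.
have dq1 : 0 <= (d%:R / q%:R : R) <= 1.
  by rewrite divr_ge0 //= ler_pdivrMr // mul1r ler_nat ltnW.
move: (piece b n) => m.
have := leq_divM (m * d) q; have := ltn_ceil (m * d) q0.
have em : (m * d %/ q <= m)%N.
  by rewrite -[leqRHS](mulnK _ q0) leq_div2r // leq_mul2l ltnW ?orbT.
rewrite natrB //; move: (m * d %/ q)%N => e.
rewrite -(ltr_nat R) -(ler_nat R) !natrM -!natr1 => h1 h2 h3 h4.
have h1' : m%:R * (d%:R / q%:R) < e%:R + 1 :> R by rewrite mulrA ltr_pdivrMr.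
have h2' : e%:R <= m%:R * (d%:R / q%:R) :> R by rewrite mulrA ler_pdivlMr.
move: (d%:R / q%:R : R) dq1 h1' h2' => x /andP[x0 x1] h1' h2'.
rewrite ler_norml; apply/andP; split; nra.
Qed.

Lemma cvg_block q d k b g : (d < q)%N -> 0 <= b -> 0 <= g ->
  block_cost k (kept q d b n)%:R (piece (b * g) n)%:R / n%:R @[n --> \oo] -->
  b * block_cost k (1 - d%:R / q%:R) g.
Proof.
move=> dq b0 g0.
have q0' : 0 < q%:R :> R by rewrite ltr0n (leq_ltn_trans _ dq).
have D0 : 0 <= 1 - d%:R / q%:R :> R.
  by rewrite subr_ge0 ler_pdivrMr // mul1r ler_nat ltnW.
have bg0 : 0 <= b * g by rewrite mulr_ge0.
rewrite -block_costM //.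
have scale n : block_cost k ((kept q d b n)%:R / n%:R : R) ((piece (b * g) n)%:R / n%:R) =
    block_cost k (kept q d b n)%:R (piece (b * g) n)%:R / n%:R.
  by rewrite ![_ / n%:R]mulrC block_costM.
under eq_cvg do rewrite -scale.
apply: cvg_block_cost => //; first exact: mulr_ge0.
  by apply: cvg_rounding => n; apply: kept_itv.
apply: cvg_rounding => n; have /andP[h1 h2] := piece_itv n bg0.
by rewrite ler_norml; apply/andP; split; lra.
Qed.

(** With [D = 1 - d / q] and [x = g / D], the terms in [ln D] coming from [x] combine into [xlnx D],
    so the bracket times [D] is a block cost over [ln q]. *)
Lemma rate_boundE q d b g : (1 < q)%N -> (d < q)%N -> 0 <= b -> 0 <= g ->
  (b%:E * rate_bound q d g)%E =
  if [&& (q - d == 1)%N, 0 < g & 0 < b] then +oo%E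
  else (b * block_cost (q - d) (1 - d%:R / q%:R) g / ln q%:R)%:E.
Proof.
move=> q1 dq b0 g0; rewrite /rate_bound.
have q0' : 0 < q%:R :> R by rewrite ltr0n (leq_ltn_trans _ dq).
have D0 : 0 < 1 - d%:R / q%:R :> R.
  by rewrite subr_gt0 ltr_pdivrMr // mul1r ltr_nat.
have -> : (q - d == 1)%N = (d.+1 == q) by apply/eqP/eqP; lia.
rewrite andbA; case: ifP => /= [/andP[_ g0']|nP].
  case: ifP => [b0'|]; first by rewrite gt0_muley ?lte_fin.
  (* An infinite bound of weight 0 counts as 0, as does the finite branch. *)
  rewrite lt_def b0 andbT => /negbFE/eqP ->; by rewrite mul0e !mul0r.
rewrite -EFinM; congr EFin; rewrite -!mulrA; congr (b * _).
rewrite /logq /block_cost (natrB _ (ltnW dq)).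
move: (1 - d%:R / q%:R) D0 => D D0.
have lnx : g * ln (g / D) = xlnx g - g * ln D.
  move: g0; rewrite le_eqVlt => /predU1P[<-|g0]; first by rewrite /xlnx !mul0r subr0.
  by rewrite ln_div ?posrE // mulrBr.
have k0 : 0 < q%:R - d%:R :> R by rewrite subr_gt0 ltr_nat.
have x1 : g / D + 1 = (D + g) / D by rewrite mulrDl mulfV ?gt_eqF // addrC.
have Dg : 0 < D + g by rewrite ltr_wpDr.
have lnk : g * ln ((q%:R - d%:R - 1) / (g / D)) =
    g * ln (q%:R - d%:R - 1) - (xlnx g - g * ln D).
  rewrite -lnx; move: g0 nP; rewrite le_eqVlt => /predU1P[<-|g0 nP].
    by rewrite !mul0r subr0.
  rewrite g0 andbT in nP.
  have dq1 : (d.+1 < q)%N by rewrite ltn_neqAle nP.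
  have k1 : 0 < q%:R - d%:R - 1 :> R.
    by move: dq1; rewrite -(ltr_nat R) -natr1; lra.
  by rewrite -mulrBr; congr (_ * _); apply: ln_div; rewrite posrE ?divr_gt0.
have lnDg : ln ((q%:R - d%:R) / (g / D + 1)) = ln (q%:R - d%:R) - (ln (D + g) - ln D).
  rewrite x1 ln_div ?posrE ?divr_gt0 //; congr (_ - _).
  by rewrite ln_div ?posrE.
have lnq : ln q%:R != 0 :> R by rewrite gt_eqF // ln_gt0 // ltr1n.
transitivity ((D + g) * (ln ((q%:R - d%:R) / (g / D + 1)) / ln q%:R)
    - (g * ln ((q%:R - d%:R - 1) / (g / D))) / ln q%:R).
  by field; rewrite lnq gt_eqF.
by rewrite lnk lnDg /xlnx; field.
Qed.

(** A monomial bound turns the list size into [ln K + e * ln n], negligible against [n]. *)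
Lemma horner_poly_bound (p : {poly R}) : exists K e, 1 <= K /\
  forall x : R, 1 <= x -> p.[x] <= K * x ^+ e.
Proof.
exists (1 + \sum_(i < size p) `|p`_i|), (size p); split.
  by rewrite lerDl sumr_ge0.
move=> x x1; have x0 : 0 <= x by apply: le_trans x1.
rewrite horner_coef; apply: (@le_trans _ _ (\sum_(i < size p) `|p`_i| * x ^+ size p)).
  apply: ler_sum => i _; apply: (@le_trans _ _ (`|p`_i| * x ^+ i)).
    by rewrite ler_wpM2r ?exprn_ge0 // ler_norm.
  by rewrite ler_wpM2l // ler_weXn2l // ltnW.
by rewrite -mulr_suml ler_wpM2r ?exprn_ge0 // lerDr.
Qed.

End Limits.

(** * Passage to the asymptotic rate *)

(** At most [n] symbols are kept and [(q - 1) n] inserted; the successor adds at most another [q n],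
    whence [2 q]. *)
Lemma ln_block_length (R : realType) q d (b g : R) n :
  0 <= b <= 1 -> 0 <= g <= q%:R - 1 -> (0 < n)%N ->
  ln (kept q d b n + piece (b * g) n).+1%:R <= ln (2 * q%:R) + ln n%:R :> R.
Proof.
move=> /andP[b0 b1] /andP[g0 gq] n0.
have n1 : 1 <= n%:R :> R by rewrite ler1n.
have q1 : 1 <= q%:R :> R by lra.
have /andP[hb _] := piece_itv n b0.
have /andP[hg _] := piece_itv n (mulr_ge0 b0 g0).
have hk : (kept q d b n)%:R <= (piece b n)%:R :> R by rewrite ler_nat leq_subr.
rewrite -lnM ?posrE ?mulr_gt0 ?(lt_le_trans _ q1) ?(lt_le_trans _ n1) //.
rewrite ler_ln ?posrE ?ltr0Sn ?mulr_gt0 ?(lt_le_trans _ q1) ?(lt_le_trans _ n1) //.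
rewrite -natr1 natrD.
have h1 : b * n%:R <= n%:R by rewrite ler_piMl // (le_trans _ n1).
have h2 : b * g * n%:R <= (q%:R - 1) * n%:R.
  rewrite ler_wpM2r ?(le_trans _ n1) //; apply: le_trans gq.
  by rewrite ler_piMl.
have h3 : n%:R <= q%:R * n%:R :> R by rewrite ler_peMl // (le_trans _ n1).
lra.
Qed.

Lemma deleted_le (R : realType) q d (b : R) n : (0 < q)%N -> 0 <= b ->
  (piece b n * d %/ q)%:R <= b * (d%:R / q%:R) * n%:R.
Proof.
move=> q0 b0; have /andP[hb _] := piece_itv n b0.
have := leq_divM (piece b n * d) q; rewrite -(ler_nat R) natrM -ler_pdivlMr ?ltr0n //.
by move=> /le_trans; apply; rewrite [leRHS]mulrAC natrM -[leLHS]mulrA ler_wpM2r //.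
Qed.

Theorem theorem2p5 (R : realType) (q d0 d1 : nat) (gamma0 gamma1 alpha : R)
    (hq : (2 <= q)%N) (hd0 : (d0 < q)%N) (hd1 : (d1 < q)%N)
    (hgamma0 : 0 <= gamma0 < q%:R - 1) (hgamma1 : 0 <= gamma1 < q%:R - 1)
    (halpha : 0 <= alpha <= 1) :
  let delta0 : R := d0%:R / q%:R in
  let delta1 : R := d1%:R / q%:R in
  let gamma : R := alpha * gamma0 + (1 - alpha) * gamma1 in
  let delta : R := alpha * delta0 + (1 - alpha) * delta1 in
  let r : \bar R := (alpha%:E * rate_bound q d0 gamma0
                     + (1 - alpha)%:E * rate_bound q d1 gamma1)%E in
  forall (S : finType) (hS : #|S| = q) (F : code_family S) (rho : R),
    family_list_decodable F gamma delta -> has_rate F rho -> (rho%:E <= r)%E.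
Proof.
move=> delta0 delta1 gamma delta r S hS F rho [L dec] rate.
have q0 : (0 < q)%N by apply: ltnW.
have /andP[a0 a1] := halpha.
have a0' : 0 <= 1 - alpha by rewrite subr_ge0.
have /andP[g00 /ltW g01] := hgamma0; have /andP[g10 /ltW g11] := hgamma1.
rewrite /r !rate_boundE //.
(* An infinite term makes the bound trivial. The finite cases return in [noins]. *)
case: ifP => [_|fin0]; first by case: ifP => _; rewrite ?addye ?leey.
case: ifP => [_|fin1]; first by rewrite addey ?leey.
rewrite -EFinD lee_fin -mulrDl.
have [K [e [K1 LK]]] := horner_poly_bound L.
pose k0 := (q - d0)%N; pose k1 := (q - d1)%N.
pose cost0 n : R :=
  block_cost k0 (kept q d0 alpha n)%:R (piece (alpha * gamma0) n)%:R.
pose cost1 n : R :=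
  block_cost k1 (kept q d1 (1 - alpha) n)%:R
    (piece ((1 - alpha) * gamma1) n)%:R.
(* [c] collects the terms independent of [n]. In [v], the coefficient [e + 2] of [ln n] comes from
   the list size and from the two word lengths. *)
pose c : R := ln K + ln ('C(q, k0) * 'C(q, k1) * q)%:R + 2 * ln (2 * q%:R).
pose v n : R := (c * n%:R^-1 + (e%:R + 2) * (ln n%:R / n%:R)
  + cost0 n / n%:R + cost1 n / n%:R) / ln q%:R.
(* If a single letter remains, finiteness of the bound forces [b = 0] or [g = 0], so nothing is
   inserted. *)
have noins k (b g : R) n :
    [&& k == 1%N, 0 < g & 0 < b] = false -> 0 <= b -> 0 <= g ->
    (k == 1)%N ==> (piece (b * g) n == 0)%N.
  move=> fin b0 g0; apply/implyP => k1'.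
  move: fin; rewrite k1' /= !lt_def b0 g0 !andbT.
  move/negbT; rewrite negb_and !negbK => /orP[]/eqP->;
    by rewrite ?mul0r ?mulr0 /piece mul0r truncn0.
have cvg_v : (v n @[n --> \oo] --> (alpha * block_cost k0 (1 - d0%:R / q%:R) gamma0
    + (1 - alpha) * block_cost k1 (1 - d1%:R / q%:R) gamma1) / ln q%:R)%classic.
  apply: cvgMr_tmp; rewrite -[X in (_ --> X + _)%classic]add0r.
  apply: cvgD; last exact: cvg_block.
  apply: cvgD; last exact: cvg_block.
  rewrite -[0]addr0; apply: cvgD.
    by rewrite -[X in (_ --> X)%classic](mulr0 c); apply: cvgMl_tmp; exact: cvg_natV.
  by rewrite -[X in (_ --> X)%classic](mulr0 (e%:R + 2)); apply: cvgMl_tmp; exact: cvg_ln_nat.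
have blocklen_ge i : (i <= blocklen F i)%N.
  elim: i => // i IH; apply: leq_ltn_trans IH _; exact: (@blocklen_incr _ F).
have cvg_len : (blocklen F i @[i --> \oo] --> \oo)%classic.
  apply/cvgnyPge => A; near=> i; apply: leq_trans (blocklen_ge i).
  by near: i; exact: nbhs_infty_ge.
(* The rate is compared with the limit of [v] along the block lengths, which tend to infinity by
   strict monotonicity. *)
apply: ler_cvg_to rate (cvg_comp _ _ cvg_len cvg_v) _.
near=> i; rewrite /comp /logq.
have n0 : (0 < blocklen F i)%N.
  by apply: leq_trans (blocklen_ge i); near: i; exact: nbhs_infty_gt.
move: (blocklen F i) (Defs.code F i) (dec i) n0 => n C {}dec n0.
have nR : 0 < n%:R :> R by rewrite ltr0n.
have n1 : 1 <= n%:R :> R by rewrite ler1n.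
have lnq : 0 < ln q%:R :> R by rewrite ln_gt0 // ltr1n.
have -> : v n = (c + (e%:R + 2) * ln n%:R + cost0 n + cost1 n) / n%:R / ln q%:R.
  by rewrite /v; ring.
rewrite hS mulrAC ler_pM2r ?invr_gt0 // ler_pM2r ?invr_gt0 //.
have /andP[p00 p01] := piece_itv n a0; have /andP[p10 p11] := piece_itv n a0'.
have ins0 := piece_itv n (mulr_ge0 a0 g00); have ins1 := piece_itv n (mulr_ge0 a0' g10).
have KK : 1 <= K * n%:R ^+ e by rewrite mulr_ege1 // exprn_ege1.
subst q.
have := @code_size_bound R S n C gamma delta L.[n%:R] (K * n%:R ^+ e) d0 d1
  (piece alpha n) (piece (1 - alpha) n) (piece (alpha * gamma0) n)
  (piece ((1 - alpha) * gamma1) n) hq hd0 hd1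
  (noins _ _ _ n fin0 a0 g00) (noins _ _ _ n fin1 a0' g10).
move=> /(_ _ _ _ dec (LK _ n1) KK) H.
(* Two floors lose less than 2 in total, hence at most one symbol. *)
have len : (piece alpha n + piece (1 - alpha) n <= n <=
    (piece alpha n + piece (1 - alpha) n).+1)%N.
  rewrite -(ler_nat R) natrD; apply/andP; split; first by lra.
  by rewrite -ltnS -(ltr_nat R) -!natr1 natrD; lra.
apply: le_trans (H len _ _) _.
- by rewrite natrD /gamma; lra.
- rewrite natrD /delta mulrDl lerD // deleted_le //.
rewrite -/k0 -/k1 lnM ?posrE ?exprn_gt0 ?(lt_le_trans _ K1) // lnXn // -[_ *+ e]mulr_natl.
have l0 : 0 <= alpha <= 1 by rewrite a0.
have l1 : 0 <= 1 - alpha <= 1 by rewrite a0' lerBlDr lerDl.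
have G0 : 0 <= gamma0 <= #|S|%:R - 1 by rewrite g00.
have G1 : 0 <= gamma1 <= #|S|%:R - 1 by rewrite g10.
have := ln_block_length d0 l0 G0 n0; have := ln_block_length d1 l1 G1 n0.
rewrite -/(kept _ _ _ _) -/(kept _ _ _ _) -/(cost0 n) -/(cost1 n) /c; lra.
Unshelve. all: by end_near. Qed.
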